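(* Let $x>0$ and condition on the distances $q$ and $q'$ of the closest blockages. The conditional probabilities $g_{\mathsf L}(x\mid q,q')=\mathbb P^{x}[E_{\mathsf L,x}\mid q,q']$ and $g_{\mathsf N}(x\mid q,q')=\mathbb P^{x}[E_{\mathsf N,x}\mid q,q']$ that the typical user is served by a LoS (respectively NLoS) BS located at $x$ are $$g_{\mathsf L}(x\mid q,q')=\begin{cases}\mathbf 1(x<q)\,e^{-\lambda x}e^{-\lambda e_{\mathsf N|\mathsf L}(x)}, & q'\le e_{\mathsf N|\mathsf L}(x),\\ \mathbf 1(x<q)\,e^{-\lambda x}e^{-\lambda q'}, & e_{\mathsf N|\mathsf L}(x)\le q'<x,\\ \mathbf 1(x<q)\,e^{-2\lambda x}, & x\le q',\end{cases}$$ $$g_{\mathsf N}(x\mid q,q')=\begin{cases}\mathbf 1(x\ge q)\,e^{-2\lambda x}, & q'<x,\\ \mathbf 1(x\ge q)\,e^{-\lambda x}e^{-\lambda q'}, & x<q'<e_{\mathsf L|\mathsf N}(x),\\ \mathbf 1(x\ge q)\,e^{-\lambda x}e^{-\lambda e_{\mathsf L|\mathsf N}(x)}, & q'>e_{\mathsf L|\mathsf N}(x).\end{cases}$$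
   Context: 1D network. Base stations (BSs) form a homogeneous Poisson point process (PPP) $\Phi$ of density $\lambda>0$ on $\mathbb R$; the typical user is at the origin. Blockages are points of an independent homogeneous PPP of density $\mu>0$ on $\mathbb R$. Let $q$ (resp. $q'$) be the distance from the origin to the nearest blockage in $(0,\infty)$ (resp. $(-\infty,0)$); these are independent with density $\mu e^{-\mu t}$, $t\ge0$. A BS at $y$ is LoS (type $\mathsf L$) if no blockage lies between $0$ and $y$ (i.e. $0<y<q$, or $y<0$ and $|y|<q'$), and NLoS (type $\mathsf N$) otherwise. Path loss (average received power): $\ell_{\mathsf L},\ell_{\mathsf N}:[0,\infty)\to[0,\infty)$ are bounded and nonincreasing with $\ell_{\mathsf L}\ge\ell_{\mathsf N}$. Exclusion radii: $e_{\mathsf L|\mathsf L}(x)=e_{\mathsf N|\mathsf N}(x)=x$, $e_{\mathsf N|\mathsf L}(x)=\min\{y\ge0:\ell_{\mathsf N}(y)\le\ell_{\mathsf L}(x)\}$, $e_{\mathsf L|\mathsf N}(x)=\min\{y\ge 0:\ell_{\mathsf L}(y)\le\ell_{\mathsf N}(x)\}$ (min read as infimum, $\infty$ if the set is empty), with $e_{\mathsf N|\mathsf L}(x)<x<e_{\mathsf L|\mathsf N}(x)$ for $x>0$. The user is served by the BS with maximum average received power: $E_{s,x}$ ($s\in\{\mathsf L,\mathsf N\}$) is the event that the BS at $x$ has type $s$ and is serving, i.e. every other BS of type $v$ is at distance greater than $e_{v|s}(x)$ from the origin, for $v\in\{\mathsf L,\mathsf N\}$. $\mathbb P^{x}$ is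 the Palm probability given that $\Phi$ has a point at $x$. *)

(* Defs.v *)
From HB Require Import structures.
From mathcomp Require Import all_boot all_order all_algebra.
From mathcomp Require Import all_classical all_reals all_analysis.
(* [all_analysis] does not export the sigma-algebra of [\bar R]. *)
From mathcomp Require Import measurable_realfun.

Set Implicit Arguments.
Unset Strict Implicit.
Unset Printing Implicit Defensive.
Import Order.TTheory GRing.Theory Num.Theory.
Import numFieldNormedType.Exports.

Local Open Scope classical_set_scope.
Local Open Scope ring_scope.

Definition count_events (R : realType) : set (set (set R)) :=
  [set F | exists (A : set R) (k : nat),
     measurable A /\ F = [set S | counting (S `&` A) = k%:R%:E :> \bar R]].

(* Point configurations on the line, with the sigma-algebra generated by the
   numbers of points in Borel sets.  Local finiteness is not built in: it holds
   almost surely for the processes considered below, since their counts in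
   bounded sets are Poisson. *)
Definition config (R : realType) := g_sigma_algebraType (@count_events R).

Definition npoints (R : realType) (S : config R) (A : set R) : \bar R :=
  counting ((S : set R) `&` A).

(* [poisson_prob] has a dummy [nat] argument. *)
Definition is_PPP (R : realType) d (Omega : measurableType d)
    (P : probability Omega R) (rate : R) (Phi : {RV P >-> config R}) : Prop :=
  (forall (A : set R) (k : nat),
     measurable A -> (lebesgue_measure A < +oo)%E ->
     P [set w | npoints (Phi w) A = k%:R%:E] =
     poisson_prob (rate * fine (lebesgue_measure A)) 0%N [set k]) /\
  (forall (n : nat) (A : 'I_n -> set R) (k : 'I_n -> nat),
     (forall i, measurable (A i) /\ (lebesgue_measure (A i) < +oo)%E) ->
     trivIset setT A ->
     P [set w | forall i, npoints (Phi w) (A i) = (k i)%:R%:E] =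
     (\prod_(i < n) P [set w | npoints (Phi w) (A i) = (k i)%:R%:E])%E).

Definition independent_RV (R : realType) d d1 d2 (Omega : measurableType d)
    (T1 : measurableType d1) (T2 : measurableType d2)
    (P : probability Omega R) (X : {RV P >-> T1}) (Y : {RV P >-> T2}) : Prop :=
  forall (F : set T1) (G : set T2), measurable F -> measurable G ->
    P (X @^-1` F `&` Y @^-1` G) = (P (X @^-1` F) * P (Y @^-1` G))%E.

Definition translate (R : realType) (t : R) (w : config R * config R) :
    config R * config R :=
  ([set y + t | y in (w.1 : set R)], [set y + t | y in (w.2 : set R)]).

(* The family of Palm distributions of the pair (Phi, Psi), Phi being a
   homogeneous process of intensity [rate]: [Palm x] is the law of (Phi, Psi)
   given that Phi has a point at x.  The first clause is the disintegration of
   the Campbell measure with respect to the mean measure of Phi; it determines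
   [Palm x] only for almost every x.  The second clause selects the
   translation-covariant version available for a jointly stationary pair, which
   makes [Palm x] well defined at every x. *)
Definition is_Palm (R : realType) d (Omega : measurableType d)
    (P : probability Omega R) (rate : R) (Phi Psi : {RV P >-> config R})
    (Palm : R.-pker R ~> (config R * config R)%type) : Prop :=
  (forall (C : set R) (F : set (config R * config R)),
     measurable C -> measurable F ->
     (\int[P]_w (npoints (Phi w) C * (\1_F (Phi w, Psi w))%:E) =
      rate%:E * \int[lebesgue_measure]_(x in C) Palm x F)%E) /\
  (forall (x t : R) (F : set (config R * config R)), measurable F ->
     Palm (x + t) F = Palm x (translate t @^-1` F)).

(* [g] is a version of the conditional probability P[E | X = .]. *)
Definition is_cond_prob (R : realType) d d' (T : measurableType d)
    (T' : measurableType d') (P : {measure set T -> \bar R}) (E : set T)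
    (X : T -> T') (g : T' -> R) : Prop :=
  [/\ measurable_fun [set: T'] g,
      P.-integrable [set: T] (fun w => (g (X w))%:E) &
      forall A : set T', measurable A ->
        P (E `&` X @^-1` A) = (\int[P]_(w in X @^-1` A) (g (X w))%:E)%E].

(* Distances from the origin to the nearest blockage on the positive and on the
   negative half-line; [+oo] on the null event that there is none. *)
Definition dist_right (R : realType) (b : config R) : \bar R :=
  ereal_inf [set y%:E | y in [set y : R | (b : set R) y /\ 0 < y]].

Definition dist_left (R : realType) (b : config R) : \bar R :=
  ereal_inf [set `|y|%:E | y in [set y : R | (b : set R) y /\ y < 0]].

Variant link := LoS | NLoS.

Definition link_type (R : realType) (b : config R) (y : R) : link :=
  if `[< (0 < y /\ (y%:E < dist_right b)%E) \/
         (y < 0 /\ (`|y|%:E < dist_left b)%E) >] then LoS else NLoS.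

Definition crossing (R : realType) (f g : R -> R) (x : R) : \bar R :=
  ereal_inf [set y%:E | y in [set y : R | 0 <= y /\ f y <= g x]].

(* [excl ell v s x] is the radius e_{v|s}(x). *)
Definition excl (R : realType) (ell : link -> R -> R) (v s : link) (x : R) :
    \bar R :=
  match v, s with
  | LoS, LoS | NLoS, NLoS => x%:E
  | NLoS, LoS => crossing (ell NLoS) (ell LoS) x
  | LoS, NLoS => crossing (ell LoS) (ell NLoS) x
  end.

(* A pair [w] consists of the base stations [w.1] and the blockages [w.2]. *)
Definition served_by (R : realType) (ell : link -> R -> R) (s : link) (x : R) :
    set (config R * config R) :=
  [set w | [/\ (w.1 : set R) x, link_type w.2 x = s &
     forall y : R, (w.1 : set R) y -> y <> x ->
       (excl ell (link_type w.2 y) s x < `|y|%:E)%E]].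

Definition blockage_dists (R : realType) (w : config R * config R) :
    \bar R * \bar R :=
  (dist_right w.2, dist_left w.2).

(* Main.v *)
(* Fix two open sets V and J of finite measure.  The Campbell formula and the
   complete independence of the Poisson process give, for almost every t outside
   V, that under the Palm distribution at t there is no base station in V and no
   blockage in J with probability exp(-lambda |V| - mu |J|); for t in V the
   probability is 0.  This holds at some t for all finite unions of rational
   intervals at once, hence for all open sets by monotone limits, and translation
   covariance carries it to every x (a weak form of Slivnyak's theorem).
   Consequently, under the Palm distribution at x, there is a point at x, fixed
   other locations carry none, and the position -Z of the nearest base station
   to the left of x is independent of (q, q').  The base station at x
   serves the user iff it has the required type and no base station lies in
   (-m, x), where m is q' clipped to the two exclusion radii, that is Z >= m.
   By independence the conditional probability is P(Z >= m) = exp(-lambda (x + m)). *)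

Require Import Defs.
From HB Require Import structures.
From mathcomp Require Import all_boot all_order all_algebra.
From mathcomp Require Import all_classical all_reals all_analysis.
From mathcomp Require Import measurable_realfun.
From mathcomp Require Import ring lra.

Set Implicit Arguments.
Unset Strict Implicit.
Unset Printing Implicit Defensive.
Import Order.TTheory GRing.Theory Num.Theory.
Import numFieldNormedType.Exports.

Local Open Scope classical_set_scope.
Local Open Scope ring_scope.

(** * Independence and null sets in probability spaces *)

Section probability_lemmas.
Local Open Scope ereal_scope.

(** Pi-lambda argument: for fixed [E1], [E2] and [c], the sets [B] satisfying the identity form a
    Dynkin class, the whole space being covered by the hypothesis on [mu E1]. It is applied with one
    random variable at a time, the constraints on the others being held in [E1] and [E2]. *)
Lemma setI_preimage_generated d d' (T : measurableType d)
    (T' : measurableType d') (R : realType)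
    (mu : probability T R) (X : T -> T') (G : set (set T'))
    (E1 E2 : set T) (c : R) :
  measurable_fun setT X -> measurable = <<s G >> -> setI_closed G ->
  measurable E1 -> measurable E2 -> (0 <= c)%R ->
  mu E1 = c%:E * mu E2 ->
  (forall B, G B -> mu (E1 `&` X @^-1` B) = c%:E * mu (E2 `&` X @^-1` B)) ->
  forall B, measurable B -> mu (E1 `&` X @^-1` B) = c%:E * mu (E2 `&` X @^-1` B).
Proof.
move=> mX mG GI mE1 mE2 c0 E12 GE B mB.
have mXB A : measurable A -> measurable (X @^-1` A).
  by move=> mA; rewrite -[_ @^-1` _]setTI; exact: mX.
have : <<s G >> B by rewrite -mG.
move: B {mB}; apply: (dynkin_induction mG GI) => //.
- by rewrite preimage_setT !setIT.
- move=> S mS PS; rewrite preimage_setC -!setDE.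
  have mI E : measurable E -> measurable (E `&` X @^-1` S).
    by move=> mE; apply: measurableI => //; exact: mXB.
  have fin E : measurable E -> mu E \is a fin_num by move=> mE; exact: fin_num_measure.
  have muD E : measurable E ->
      mu (E `\` X @^-1` S) = mu E - mu (E `&` X @^-1` S).
    by move=> mE; rewrite measureD ?ltey_eq ?fin//; exact: mXB.
  rewrite (muD _ mE1) (muD _ mE2) E12 PS muleBr//.
  by apply: fin_num_adde_defr; exact: fin.
- move=> F mF tF PF; rewrite preimage_bigcup !setI_bigcupr.
  have tI E : trivIset setT (fun k => E `&` X @^-1` F k).
    by move=> i j _ _ [w [[_ Fi] [_ Fj]]]; apply: tF => //; exists (X w).
  have mEF E : measurable E -> forall k, measurable (E `&` X @^-1` F k).
    by move=> mE k; apply: measurableI => //; exact: mXB.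
  have muU E : measurable E -> mu (\bigcup_k (E `&` X @^-1` F k)) =
      \sum_(k <oo) mu (E `&` X @^-1` F k).
    move=> mE; rewrite measure_bigcup//; last by move=> k _; exact: mEF.
    by apply: eq_eseriesl => k; rewrite in_setT.
  by rewrite muU// muU// -nneseriesZl//; apply: eq_eseriesr.
Qed.

(** The product formula on rectangles identifies the joint law with the product measure, whose value
    on [D] is the integral of the measures of its sections. *)
Lemma joint_probabilityE d d1 d2 (T : measurableType d)
    (T1 : measurableType d1) (T2 : measurableType d2) (R : realType)
    (P : probability T R) (X : {mfun T >-> T1}) (Z : {mfun T >-> T2}) :
  (forall A B, measurable A -> measurable B ->
     P (X @^-1` A `&` Z @^-1` B) = P (X @^-1` A) * P (Z @^-1` B)) ->
  forall D, measurable D ->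
    P [set w | D (X w, Z w)] =
    \int[distribution P X]_p distribution P Z (xsection D p).
Proof.
move=> XZ D mD.
pose f w := (X w, Z w).
have mf : measurable_fun setT f by apply/measurable_fun_pairP; split; exact: measurable_funP.
pose XZ_ : {mfun T >-> (T1 * T2)%type} := mfun_Sub (mem_set mf).
rewrite -[LHS]/(distribution P XZ_ D).
rewrite -[RHS]/((distribution P X \x distribution P Z) D).
apply/esym/product_measure_unique => // A B mA mB; exact: XZ.
Qed.

Lemma eq_probability_mod_null d (T : measurableType d) (R : realType)
    (P : probability T R) (A B N : set T) :
  measurable A -> measurable B -> measurable N -> P N = 0 ->
  A `<=` B `|` N -> B `<=` A `|` N -> P A = P B.
Proof.
move=> mA mB mN N0 AB BA.
have le C D : measurable C -> measurable D -> C `<=` D `|` N -> P C <= P D.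
  move=> mC mD CD; rewrite -(measureU0 mD mN N0).
  by apply: le_measure => //; apply: mem_set => //; exact: measurableU.
by apply/eqP; rewrite eq_le !le.
Qed.

End probability_lemmas.

(** The image of Lebesgue measure under a translation gives half-open intervals their length, and
    this determines Lebesgue measure. *)
Lemma lebesgue_measure_shift (R : realType) (s : R) (A : set R) : measurable A ->
  lebesgue_measure ((fun y => y + s) @^-1` A) = lebesgue_measure A.
Proof.
move=> mA.
pose f : measurableTypeR R -> measurableTypeR R := fun y => y + s.
have mf : measurable_fun setT f by exact: measurable_funD.
rewrite -[LHS]/(pushforward lebesgue_measure (mfun_Sub (mem_set mf)) A).
apply/esym/lebesgue_measure_unique => //= _ [[a b]] _ <-.
rewrite /pushforward.
rewrite [X in _ = lebesgue_measure X](_ : _ = [set` `]a - s, b - s]]).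
  rewrite !lebesgue_measure_itv/= !lte_fin ltrD2r -!EFinB.
  by case: ifP => // _; congr (_%:E); lra.
by apply/seteqP; split => y /=; rewrite !in_itv/= ltrBlDr lerBrDr.
Qed.

Lemma itv_lty (R : realType) (a b : R) :
  (lebesgue_measure (`]a, b[%classic : set R) < +oo)%E.
Proof. by rewrite lebesgue_measure_itv/=; case: ifP => _; rewrite -?EFinB ltry. Qed.

(** * Counts as series of indicators *)

Section counting.
Local Open Scope ereal_scope.

Lemma counting_eq0 (R : realType) (T : choiceType) (A : set T) :
  (counting A = 0 :> \bar R) <-> A = set0.
Proof.
split=> [|->]; rewrite /counting; last by rewrite asboolT// fset_set0.
case: asboolP => // fA [/eqP]; rewrite pnatr_eq0 finmap.cardfs_eq0 => /eqP.
exact: fset_set_set0.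
Qed.

(** Layer-cake formula: a count [n] is the number of naturals [k < n], and an infinite count exceeds
    all of them. As a series of indicators it can be integrated term by term. *)
Lemma counting_series (R : realType) (T : choiceType) (A : set T) :
  counting A = \sum_(k <oo) (\1_(fun k : nat => (k%:R%:E < counting A :> \bar R)%E) k)%:E
  :> \bar R.
Proof.
transitivity (counting [set k : nat | k%:R%:E < counting A :> \bar R] : \bar R);
  last by rewrite counting_dirac.
rewrite {2}/counting /counting; case: (asboolP (finite_set A)) => fA; last first.
  rewrite asboolF//; apply: contra_not infinite_nat.
  by congr finite_set; apply/seteqP; split => // k _ /=; rewrite ltry.
have /finite_setP[n An] := fA; rewrite (card_fset_set An).
have -> : [set k : nat | k%:R%:E < n%:R%:E :> \bar R] = `I_n.
  by apply/seteqP; split => k /=; rewrite lte_fin ltr_nat.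
by rewrite asboolT// (card_fset_set (card_eqxx _)).
Qed.

(* The count [N] is the sum over [k] of the indicators of [N > k], also when
   [N = +oo]; hence [N] and [G] decouple as soon as all the levels of [N] do. *)
Lemma integral_counting_indep d (T : measurableType d) (R : realType)
    (U : choiceType) (P : probability T R) (Y : T -> set U) (G : set T) :
  measurable G ->
  (forall k, measurable [set w | counting (Y w) = k%:R%:E :> \bar R]) ->
  (forall k, P (G `&` [set w | counting (Y w) = k%:R%:E :> \bar R]) =
             P G * P [set w | counting (Y w) = k%:R%:E :> \bar R]) ->
  \int[P]_w (counting (Y w) * (\1_G w)%:E) = P G * \int[P]_w counting (Y w).
Proof.
move=> mG mY GY.
pose gt k := [set w | k%:R%:E < counting (Y w) :> \bar R].
pose eqk k := [set w | counting (Y w) = k%:R%:E :> \bar R].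
have cnat w : counting (Y w) = +oo :> \bar R \/ exists n, counting (Y w) = n%:R%:E :> \bar R.
  by rewrite /counting; case: ifPn => _; [right; eexists|left].
have gt0E : gt 0%N = ~` eqk 0%N.
  apply/seteqP; split => w; rewrite /gt /eqk/=; first by move=> /lt_eqF/eqP/nesym.
  case: (cnat w) => [->|[n ->]]; first by rewrite ltry.
  by rewrite lte_fin ltr_nat; case: n.
have gtS k : gt k.+1 = gt k `\` eqk k.+1.
  apply/seteqP; split => w; rewrite /gt /eqk/=.
    move=> h; split; first by apply: lt_trans h; rewrite lte_fin ltr_nat.
    by apply/nesym/eqP; rewrite lt_eqF.
  case: (cnat w) => [->|[n ->]]; first by rewrite !ltry.
  rewrite !lte_fin !ltr_nat => -[kn nk]; rewrite ltn_neqAle kn andbT.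
  by apply/eqP => kn'; apply: nk; rewrite kn'.
have me k : measurable (eqk k) := mY k.
have fin A : measurable A -> P A \is a fin_num by move=> mA; exact: fin_num_measure.
have PD A B : measurable A -> measurable B -> P (A `\` B) = P A - P (A `&` B).
  by move=> mA mB; rewrite measureD// ltey_eq fin.
(* Independence of [G] passes to proper differences. The induction below starts from the sure event
   and removes the levels [eqk k] one after the other. *)
have GD A B : measurable A -> measurable B -> B `<=` A ->
    P (G `&` A) = P G * P A -> P (G `&` B) = P G * P B ->
    P (G `&` (A `\` B)) = P G * P (A `\` B).
  move=> mA mB BA GA GB; rewrite setIDA !PD//; last exact: measurableI.
  rewrite -setIA (setIidr BA) GA GB muleBr// ?fin//.
  by apply: fin_num_adde_defr; exact: fin.
have [mgt Pgt] : (forall k, measurable (gt k)) /\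
    forall k, P (G `&` gt k) = P G * P (gt k).
  suff H k : measurable (gt k) /\ P (G `&` gt k) = P G * P (gt k).
    by split=> k; case: (H k).
  elim: k => [|k [mk IH]].
    rewrite gt0E -setTD; split; first exact: measurableD.
    by apply: GD => //; [rewrite setIT probability_setT mule1|exact: GY].
  rewrite gtS; split; first exact: measurableD.
  apply: GD => //; last exact: GY.
  by move=> w; rewrite /eqk /gt/= => ->; rewrite lte_fin ltr_nat.
under eq_integral => w _ do rewrite muleC counting_series -nneseriesZl//.
under [in RHS]eq_integral => w _ do rewrite counting_series.
have idE w k : \1_(fun k : nat => (k%:R%:E < counting (Y w) :> \bar R)%E) k = \1_(gt k) w :> R.
  by rewrite !indicE /gt; congr (_%:R); apply/idP/idP; rewrite !inE.
have mgtk k : measurable_fun setT (fun w =>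
    (\1_(fun k : nat => (k%:R%:E < counting (Y w) :> \bar R)%E) k)%:E : \bar R).
  apply/measurable_EFinP; rewrite (_ : (fun w => _) = \1_(gt k)).
    exact: measurable_indic.
  by apply/funext => w; rewrite idE.
rewrite integral_nneseries//; last first.
  move=> k; apply: emeasurable_funM => //.
  by apply/measurable_EFinP; exact: measurable_indic.
rewrite integral_nneseries//.
rewrite -[P G]fineK ?fin// -nneseriesZl//; last first.
  by move=> k _; apply: integral_ge0 => w _; rewrite lee_fin.
apply: eq_eseriesr => k _; rewrite fineK ?fin//.
under eq_integral => w _ do rewrite idE -EFinM.
under [in RHS]eq_integral => w _ do rewrite idE.
have mGg : measurable (G `&` gt k) by exact: measurableI.
rewrite [RHS](_ : _ = P (G `&` gt k)); last by rewrite integral_indic// setIT Pgt.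
rewrite -[X in P X]setIT -integral_indic//.
by apply: eq_integral => w _; rewrite indicI.
Qed.

End counting.

(** * Vacancy probabilities under the Palm distributions *)

(** For intervals [V] and [J], these events express the lower bounds on the nearest-point
    distances. *)
Definition vacant (R : realType) (V J : set R) : set (config R * config R) :=
  [set w | (w.1 : set R) `&` V = set0 /\ (w.2 : set R) `&` J = set0].

Section vacant_probability.
Local Open Scope ereal_scope.
Context (R : realType).
Implicit Types (V J C : set R).

Lemma measurable_npoints_eq C (k : nat) : measurable C ->
  measurable [set S : config R | npoints S C = k%:R%:E].
Proof. by move=> mC; apply: sub_sigma_algebra; exists C, k. Qed.

Lemma npoints_eq0 C (S : config R) :
  npoints S C = 0%:R%:E <-> (S : set R) `&` C = set0.
Proof. exact: counting_eq0. Qed.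

Lemma measurable_avoid C : measurable C ->
  measurable [set S : config R | (S : set R) `&` C = set0].
Proof.
move=> mC; rewrite (_ : [set S | _] = [set S : config R | npoints S C = 0%:R%:E]).
  exact: measurable_npoints_eq.
by apply/seteqP; split => S /npoints_eq0.
Qed.

Lemma measurable_vacant V J : measurable V -> measurable J ->
  measurable (vacant V J).
Proof.
move=> mV mJ; rewrite (_ : vacant V J = [set S : config R | (S : set R) `&` V = set0] `*`
  [set S : config R | (S : set R) `&` J = set0])//.
by apply: measurableX; exact: measurable_avoid.
Qed.

Lemma PPP_avoid d (Omega : measurableType d) (P : probability Omega R)
    (rate : R) (Phi : {RV P >-> config R}) V :
  (0 < rate)%R -> is_PPP rate Phi -> measurable V -> lebesgue_measure V < +oo ->
  P [set w | npoints (Phi w) V = 0%:R%:E] =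
  (expR (- (rate * fine (lebesgue_measure V))))%:E.
Proof.
move=> rate0 [PPP _] mV Voo; rewrite PPP// /poisson_prob.
have [r0|r0] := ltP.
  rewrite esum_set1 ?lee_fin ?poisson_pmf_ge0//.
  by rewrite /poisson_pmf r0 expr0 fact0 invr1 !mul1r.
(* For a null set [V] the parameter is 0, where [poisson_prob] is the Dirac mass at 0. *)
have -> : (rate * fine (lebesgue_measure V) = 0)%R.
  by apply/eqP; rewrite eq_le r0/= mulr_ge0 ?(ltW rate0)//; exact/fine_ge0.
by rewrite oppr0 expR0 diracE mem_set.
Qed.

Lemma PPP_indep2 d (Omega : measurableType d) (P : probability Omega R)
    (rate : R) (Phi : {RV P >-> config R}) V C (j k : nat) :
  is_PPP rate Phi -> measurable V -> measurable C -> lebesgue_measure V < +oo ->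
  lebesgue_measure C < +oo -> V `&` C = set0 ->
  P (Phi @^-1` ([set S | npoints S V = j%:R%:E] `&`
                [set S | npoints S C = k%:R%:E])) =
  P (Phi @^-1` [set S | npoints S V = j%:R%:E]) *
  P (Phi @^-1` [set S | npoints S C = k%:R%:E]).
Proof.
move=> [_ ind] mV mC Voo Coo VC.
pose A (i : 'I_2) := if val i is 0%N then V else C.
pose n (i : 'I_2) := if val i is 0%N then j else k.
have := ind 2%N A n; rewrite big_ord_recl big_ord1 /A /n/= => <-.
- congr (P _); apply/seteqP; split => w /=.
    by move=> [? ?] [[|[|//]] ?].
  by move=> h; split; [exact: (h ord0)|exact: (h (lift ord0 ord0))].
- by move=> [[|[|//]] ?].
- move=> [[|[|//]] hi] [[|[|//]] hj] _ _ /= [y [Ay By]]; try exact: val_inj;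
    by exfalso; have : (V `&` C) y by []; rewrite VC.
Qed.

Context d (Omega : measurableType d) (P : probability Omega R) (lambda mu : R)
  (Phi Psi : {RV P >-> config R}) (Palm : R.-pker R ~> (config R * config R)%type).
Hypotheses (hlambda : (0 < lambda)%R) (hmu : (0 < mu)%R)
  (hPhi : is_PPP lambda Phi) (hPsi : is_PPP mu Psi)
  (hindep : independent_RV Phi Psi) (hPalm : is_Palm lambda Phi Psi Palm).

(** Void probability of two independent Poisson processes. It is meaningful for sets of finite
    measure: [fine] sends an infinite measure to 0. *)
Definition vacant_prob (V J : set R) : R :=
  expR (- (lambda * fine (lebesgue_measure V))) *
  expR (- (mu * fine (lebesgue_measure J))).

(* On [vacant V J] the points of [Phi] in [C] lie in [C `\` V], and their number
   is independent of [vacant V J]; its mean comes from the Campbell formula for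
   the sure event. *)
Lemma campbell_vacant V J C : measurable V -> measurable J -> measurable C ->
  lebesgue_measure V < +oo -> lebesgue_measure J < +oo ->
  lebesgue_measure C < +oo ->
  \int[lebesgue_measure]_(t in C) Palm t (vacant V J) =
  \int[lebesgue_measure]_(t in C) (\1_(~` V) t * vacant_prob V J)%:E.
Proof.
move=> mV mJ mC Voo Joo Coo.
have mCV : measurable (C `\` V) by exact: measurableD.
have mvacant := measurable_vacant mV mJ.
pose G := [set w | vacant V J (Phi w, Psi w)].
have GE : G = Phi @^-1` [set S | npoints S V = 0%:R%:E] `&`
             Psi @^-1` [set S | npoints S J = 0%:R%:E].
  by apply/seteqP; split => w /=; rewrite /G /vacant /= => -[/npoints_eq0 ? /npoints_eq0 ?].
have mG : measurable G.
  rewrite GE; apply: measurableI; apply: measurable_funPTI; exact: measurable_npoints_eq.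
have PG : P G = (vacant_prob V J)%:E.
  rewrite GE hindep; try exact: measurable_npoints_eq.
  rewrite (PPP_avoid hlambda hPhi mV Voo : P (Phi @^-1` _) = _).
  by rewrite (PPP_avoid hmu hPsi mJ Joo : P (Psi @^-1` _) = _).
have [campbell _] := hPalm.
have CVoo : lebesgue_measure (C `\` V) < +oo.
  by apply: le_lt_trans Coo; apply: le_measure; [exact: mem_set..|by move=> ? []].
have EN : \int[P]_w npoints (Phi w) (C `\` V) = lambda%:E * lebesgue_measure (C `\` V).
  have := campbell _ _ mCV measurableT.
  under eq_integral => w _ do rewrite indicT mule1.
  move=> ->; congr (_ * _).
  under eq_integral => w _ do rewrite prob_kernel.
  by rewrite integral_cst// mul1e.
have Ecampbell : lambda%:E * \int[lebesgue_measure]_(t in C) Palm t (vacant V J) =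
    P G * \int[P]_w npoints (Phi w) (C `\` V).
  rewrite -campbell// -integral_counting_indep//.
  - apply: eq_integral => w _.
    rewrite (_ : \1_(vacant V J) (Phi w, Psi w) = \1_G w :> R); last first.
      by rewrite !indicE; congr (_%:R); apply/idP/idP => /set_mem h; exact: mem_set.
    rewrite indicE; case: (boolP (w \in G)) => [/set_mem[/= PhiV _]|_]; last by rewrite !mule0.
    rewrite /npoints; congr (counting _ * _).
    apply/seteqP; split=> y [Py Cy]; split => //; last by case: Cy.
    by split=> // Vy; have : (set0 : set R) y by rewrite -PhiV.
  - by move=> k; exact: (measurable_funPTI Phi (measurable_npoints_eq k mCV)).
  (* The event splits first by the independence of [Phi] and [Psi], then by that of the counts of
     [Phi] in the disjoint sets [V] and [C \ V]. *)
  - move=> k; rewrite GE setIAC.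
    rewrite (_ : _ `&` _ `&` _ = (Phi @^-1` ([set S | npoints S V = 0%:R%:E] `&`
      [set S | npoints S (C `\` V) = k%:R%:E])) `&`
      Psi @^-1` [set S | npoints S J = 0%:R%:E]); last first.
      by apply/seteqP; split => w /= [[]].
    rewrite !hindep; do 1?[exact: measurable_npoints_eq|
      by apply: measurableI; exact: measurable_npoints_eq].
    rewrite (PPP_indep2 _ _ hPhi)//; last by rewrite setICA setICr !setI0.
    by rewrite muleAC.
have lamK : cancel (fun a => lambda%:E * a) (fun a => lambda^-1%:E * a).
  by move=> a; rewrite muleA -EFinM mulVf ?gt_eqF// mul1e.
apply: (can_inj lamK); rewrite Ecampbell PG EN muleCA; congr (_ * _).
rewrite [RHS](_ : _ = \int[lebesgue_measure]_(t in C)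
  ((vacant_prob V J)%:E * (\1_(~` V) t)%:E)); last first.
  by apply: eq_integral => t _; rewrite -EFinM mulrC.
rewrite ge0_integralZl//; last 2 first.
- by apply/measurable_EFinP; apply: measurable_indic; exact: measurableC.
- by rewrite lee_fin mulr_ge0 ?expR_ge0.
by rewrite integral_indic ?setDE 1?setIC//; exact: measurableC.
Qed.

(* The restriction to [-n, n] makes the two sides integrable. *)
Lemma ae_vacant V J : measurable V -> measurable J ->
  lebesgue_measure V < +oo -> lebesgue_measure J < +oo ->
  \forall t \ae lebesgue_measure,
    Palm t (vacant V J) = (\1_(~` V) t * vacant_prob V J)%:E.
Proof.
move=> mV mJ Voo Joo; have mvacant := measurable_vacant mV mJ.
suff H (n : nat) : ae_eq lebesgue_measure `[(- n%:R)%R, n%:R]%classic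
    (fun t => (\1_(~` V) t * vacant_prob V J)%:E) (Palm ^~ (vacant V J)).
  have : \forall t \ae lebesgue_measure, forall n : nat,
      `[(- n%:R)%R, n%:R]%classic t ->
      (\1_(~` V) t * vacant_prob V J)%:E = Palm t (vacant V J).
    by apply: ae_foralln => n; exact: (H n).
  apply: negligibleS => t /=; apply: contra_not.
  move=> /(_ (Num.truncn `|t|).+1) -> //=.
  by rewrite in_itv/= -ler_norml ltW// truncnS_gt.
have noo : lebesgue_measure (`[(- n%:R)%R, n%:R]%classic : set R) < +oo.
  by rewrite lebesgue_measure_itv/=; case: ifP => _; rewrite /= -?EFinB ltry.
(* By [campbell_vacant] the two functions have the same integral over every measurable subset of the
   interval. *)
apply: integral_ae_eq => //.
- apply/integrableP; split.
    apply/measurable_EFinP; apply: measurable_funM => //.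
    by apply: measurable_indic; exact: measurableC.
  apply: (@le_lt_trans _ _ (\int[lebesgue_measure]_(t in `[(- n%:R)%R, n%:R]%classic)
      (cst (vacant_prob V J)%:E t))).
    apply: ge0_le_integral => //.
    + apply: measurableT_comp => //.
      apply/measurable_EFinP; apply: measurable_funM => //.
      by apply: measurable_indic; exact: measurableC.
    + move=> t _ /=; rewrite lee_fin ger0_norm ?mulr_ge0 ?expR_ge0//.
      by rewrite ler_piMl ?mulr_ge0 ?expR_ge0// indicE lern1 leq_b1.
  by rewrite integral_cst// lte_mul_pinfty// lee_fin mulr_ge0 ?expR_ge0.
- by apply: measurable_funTS; exact: (measurable_kernel Palm _ mvacant).
- move=> E En mE; rewrite campbell_vacant//.
  by apply: le_lt_trans noo; apply: le_measure => //; exact: mem_set.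
Qed.

(** A countable family of open sets, closed under finite unions, whose increasing limits give all
    open sets. *)
Definition rat_itvs (s : seq (rat * rat)) : set R :=
  \big[setU/set0]_(p <- s) `]ratr p.1, ratr p.2[%classic.

Lemma measurable_rat_itvs s : measurable (rat_itvs s).
Proof. by apply: bigsetU_measurable. Qed.

Lemma rat_itvs_lty s : lebesgue_measure (rat_itvs s) < +oo.
Proof.
rewrite /rat_itvs; elim: s => [|p s IH]; first by rewrite big_nil measure0.
rewrite big_cons; apply: (le_lt_trans (measureU2 _ _ _)) => //.
  exact: measurable_rat_itvs.
by rewrite lte_add_pinfty// itv_lty.
Qed.

(* Countably many almost-everywhere identities hold simultaneously at some [t]. *)
Lemma vacant_rat_itvs : exists t, forall s u,
  Palm t (vacant (rat_itvs s) (rat_itvs u)) =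
  (\1_(~` rat_itvs s) t * vacant_prob (rat_itvs s) (rat_itvs u))%:E.
Proof.
have : \forall t \ae lebesgue_measure, forall n : nat,
    if unpickle n is Some (s, u) then
      Palm t (vacant (rat_itvs s) (rat_itvs u)) =
      (\1_(~` rat_itvs s) t * vacant_prob (rat_itvs s) (rat_itvs u))%:E
    else True.
  apply: ae_foralln => n; case: (unpickle n) => [[s u]|]; last exact/aeW.
  by apply: ae_vacant; do ?[exact: measurable_rat_itvs|exact: rat_itvs_lty].
(* If no [t] were good, the whole line would be negligible, although its measure is infinite. *)
move=> good; apply: contrapT => /forallNP bad.
have : lebesgue_measure.-negligible [set: R].
  apply: negligibleS good => t _ /= h; apply: (bad t) => s u.
  by have := h (pickle (s, u)); rewrite pickleK.
move=> /(measure_negligible measurableT); rewrite -set_itvNyy.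
by have := lebesgue_measure_itv (`]-oo, +oo[ : interval R) => /= ->.
Qed.

Lemma open_rat_itvs V : open V -> exists s : nat -> seq (rat * rat),
  nondecreasing_seq (fun n => rat_itvs (s n)) /\ \bigcup_n rat_itvs (s n) = V.
Proof.
move=> oV.
pose itv (p : rat * rat) : set R := `]ratr p.1, ratr p.2[%classic.
(* [s n] lists the rational intervals inside [V] with code below [n]. Since [pickle_inv] answers
   only on actual codes, membership does bound [pickle p]. *)
pose s n := [seq p <- pmap (@pickle_inv (rat * rat)%type) (iota 0 n) | `[< itv p `<=` V >]].
have itvsP n y : rat_itvs (s n) y <-> exists p, p \in s n /\ itv p y.
  rewrite /rat_itvs; elim: (s n) => [|p u IH].
    by rewrite big_nil; split => // -[p []].
  rewrite big_cons; split.
    case=> [py|/IH[p' [p'u p'y]]]; first by exists p; rewrite mem_head.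
    by exists p'; rewrite in_cons p'u orbT.
  move=> [p' []]; rewrite in_cons => /orP[/eqP->|p'u] p'y; first by left.
  by right; apply/IH; exists p'.
have sP n p : p \in s n <-> (itv p `<=` V /\ (pickle p < n)%N).
  rewrite mem_filter mem_pmap; split.
    move=> /andP[/asboolP pV /mapP[k]]; rewrite mem_iota add0n => /andP[_ kn] pk.
    by split => //; have := @pickle_invK (rat * rat)%type k; rewrite -pk /= => ->.
  move=> [pV pn]; apply/andP; split; first exact/asboolP.
  by apply/mapP; exists (pickle p); rewrite ?mem_iota// pickleK_inv.
exists s; split.
  move=> m n mn; apply/subsetPset => y /itvsP[p [/sP[pV pm] py]].
  by apply/itvsP; exists p; split => //; apply/sP; split => //; exact: leq_trans mn.
apply/seteqP; split => y.
  by move=> [n _ /itvsP[p [/sP[pV _] py]]]; exact: pV.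
move=> Vy; have /nbhs_ballP[e /= e0 eV] : nbhs y V by exact: open_nbhs_nbhs.
have [a /andP[ya ay]] : exists a, (y - e < ratr a < y)%R.
  have /rat_in_itvoo[b] : (y - e < y)%R by lra.
  by rewrite in_itv/= => h; exists b; exact: h.
have [b /andP[yb byy]] : exists a, (y < ratr a < y + e)%R.
  have /rat_in_itvoo[b] : (y < y + e)%R by lra.
  by rewrite in_itv/= => h; exists b; exact: h.
exists (pickle (a, b)).+1 => //; apply/itvsP; exists (a, b); split; last first.
  by rewrite /itv/= in_itv/= ay yb.
apply/sP; split => // z; rewrite /itv/= in_itv/= => /andP[az zb].
by apply: eV; rewrite /ball/= ltr_norml; apply/andP; split; lra.
Qed.

(** Continuity of Lebesgue measure from below; finiteness of the limit allows passing to real values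
    through [fine]. *)
Lemma cvg_vacant_prob (V J : nat -> set R) :
  (forall n, measurable (V n)) -> (forall n, measurable (J n)) ->
  nondecreasing_seq V -> nondecreasing_seq J ->
  lebesgue_measure (\bigcup_n V n) < +oo -> lebesgue_measure (\bigcup_n J n) < +oo ->
  vacant_prob (V n) (J n) @[n --> \oo] --> vacant_prob (\bigcup_n V n) (\bigcup_n J n).
Proof.
move=> mV mJ ndV ndJ Voo Joo.
have fin_cvg (A : nat -> set R) (c : R) : (forall n, measurable (A n)) ->
    nondecreasing_seq A -> lebesgue_measure (\bigcup_n A n) < +oo ->
    expR (- (c * fine (lebesgue_measure (A n)))) @[n --> \oo] -->
    expR (- (c * fine (lebesgue_measure (\bigcup_n A n)))).
  move=> mA ndA Aoo; apply: continuous_cvg; first exact: continuous_expR.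
  apply: cvgN; apply: cvgMr; apply: fine_cvg; rewrite fineK.
    by apply: nondecreasing_cvg_mu => //; exact: bigcupT_measurable.
  by rewrite ge0_fin_numE.
by apply: cvgM; exact: fin_cvg.
Qed.

(** Avoiding an increasing union is the decreasing intersection of the events of avoiding its
    members, so both sides are limits along rational unions. If [t] is in [V], it is already in some
    member, and the probability is 0 from there on. *)
Lemma vacant_open t : (forall s u, Palm t (vacant (rat_itvs s) (rat_itvs u)) =
    (\1_(~` rat_itvs s) t * vacant_prob (rat_itvs s) (rat_itvs u))%:E) ->
  forall V J, open V -> open J ->
  lebesgue_measure V < +oo -> lebesgue_measure J < +oo ->
  Palm t (vacant V J) = (\1_(~` V) t * vacant_prob V J)%:E.
Proof.
move=> H V J /open_rat_itvs[s [nds <-]] /open_rat_itvs[u [ndu <-]] Voo Joo.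
set Vn := fun n => rat_itvs (s n); set Jn := fun n => rat_itvs (u n).
have mVn n : measurable (Vn n) by exact: measurable_rat_itvs.
have mJn n : measurable (Jn n) by exact: measurable_rat_itvs.
have vacantE : vacant (\bigcup_n Vn n) (\bigcup_n Jn n) = \bigcap_n vacant (Vn n) (Jn n).
  apply/seteqP; split => w; rewrite /vacant/=.
    rewrite !setI_bigcupr => -[/bigcup0P h1 /bigcup0P h2] n _.
    by split; [exact: h1|exact: h2].
  by move=> h; rewrite !setI_bigcupr; split; apply: bigcup0 => n _; case: (h n I).
have mvacantn n : measurable (vacant (Vn n) (Jn n)) by exact: measurable_vacant.
have mvacant : measurable (\bigcap_n vacant (Vn n) (Jn n)).
  exact: bigcap_measurable.
rewrite vacantE.
have [[n _ tn]|tV] := pselect ((\bigcup_n Vn n) t).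
  rewrite indicE memNset ?mul0r; last by move=> h; apply: h; exists n.
  apply/eqP; rewrite -measure_le0.
  have -> : 0 = Palm t (vacant (Vn n) (Jn n)).
    by rewrite H indicE memNset ?mul0r// => h; apply: h.
  by apply: le_measure; rewrite ?inE//; exact: bigcap_inf.
rewrite indicE mem_set// mul1r.
have cvg_Palm : Palm t (vacant (Vn n) (Jn n)) @[n --> \oo] -->
    Palm t (\bigcap_n vacant (Vn n) (Jn n)).
  apply: nonincreasing_cvg_mu => //; first by rewrite H ltry.
  move=> m n mn; apply/subsetPset => w [wV wJ]; split; apply/seteqP; split => // y [wy].
    by move=> Vy; rewrite -wV; split => //; move: y Vy {wy}; exact/subsetPset/nds.
  by move=> Vy; rewrite -wJ; split => //; move: y Vy {wy}; exact/subsetPset/ndu.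
apply: (cvg_unique (@ereal_hausdorff R) cvg_Palm).
rewrite (_ : (fun n => _) = EFin \o (fun n => vacant_prob (Vn n) (Jn n))).
  by apply: cvg_EFin; [exact: nearW|exact: cvg_vacant_prob].
apply/funext => n /=; rewrite H indicE mem_set ?mul1r// => Vt.
by apply: tV; exists n.
Qed.

(* Covariance carries the identity from one good [t] to every [x]. *)
Lemma Palm_vacant x V J : open V -> open J ->
  lebesgue_measure V < +oo -> lebesgue_measure J < +oo ->
  Palm x (vacant V J) = (\1_(~` V) x * vacant_prob V J)%:E.
Proof.
move=> oV oJ Voo Joo; have [t /vacant_open tP] := vacant_rat_itvs.
have [_ cov] := hPalm.
have mV := open_measurable oV; have mJ := open_measurable oJ.
rewrite -[x](subrKC t) cov; last exact: measurable_vacant.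
pose sh (y : R) := (y + (x - t))%R.
have -> : translate (x - t) @^-1` vacant V J = vacant (sh @^-1` V) (sh @^-1` J).
  have shE (S U : set R) : [set y + (x - t) | y in S]%R `&` U = set0 <-> S `&` (sh @^-1` U) = set0.
    split=> [h|h]; apply/seteqP; split => // y [].
      by move=> Sy Uy; have : set0 (sh y) by rewrite -h; split => //; exists y.
    by move=> [z Sz <-] Uz; have : set0 z by rewrite -h.
  by apply/seteqP; split => w [] /shE ? /shE ?.
have csh : continuous sh by move=> y; apply: cvgD; [exact: cvg_id|exact: cvg_cst].
(* As [sh t] is [x], the indicator is unchanged; the measures are unchanged by translation
   invariance. *)
rewrite tP.
- by rewrite /vacant_prob !lebesgue_measure_shift.
- by move/continuousP : csh; exact.
- by move/continuousP : csh; exact.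
- by rewrite lebesgue_measure_shift.
- by rewrite lebesgue_measure_shift.
Qed.

End vacant_probability.

Section kernel_probability.
Context d d' (X : measurableType d) (Y : measurableType d') (R : realType)
  (k : R.-pker X ~> Y) (x : X).

(** A named form of [k x], to which the structure of a probability measure is attached. *)
Definition kernel_at : set Y -> \bar R := k x.

HB.instance Definition _ := Measure.on kernel_at.
HB.instance Definition _ := Measure_isProbability.Build _ _ R kernel_at (prob_kernel x).

End kernel_probability.

(** * Nearest points *)

Section nearest_points.
Local Open Scope ereal_scope.
Context (R : realType).
Implicit Types (x : R) (S : config R).

(* [- gap_left x S] is the nearest point of [S] to the left of [x]. *)
Definition gap_left x S : \bar R :=
  ereal_inf [set (- y)%R%:E | y in [set y : R | (S : set R) y /\ (y < x)%R]].

(** A weak inequality corresponds to an open interval, so the lower bounds on the gap are vacancy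
    events of open sets. *)
Lemma le_gap_left x S (m : R) :
  (m%:E <= gap_left x S) <-> (S : set R) `&` `](- m)%R, x[%classic = set0.
Proof.
split=> [mS|SE].
  apply/seteqP; split => // y [Sy] /=; rewrite in_itv/= => /andP[my yx].
  have : m%:E <= (- y)%R%:E by apply: (le_trans mS); apply: ereal_inf_lbound; exists y.
  by rewrite lee_fin lerNr leNgt my.
apply: le_ereal_inf_tmp => _ [y [Sy yx] <-]; rewrite lee_fin leNgt.
apply/negP => my; have : (set0 : set R) y; last by [].
by rewrite -SE; split => //=; rewrite in_itv/= yx andbT ltrNl.
Qed.

Lemma dist_leftE (S : config R) : dist_left S = gap_left 0 S.
Proof.
rewrite /dist_left /gap_left; congr ereal_inf; apply/seteqP; split => _ [y [Sy y0] <-];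
  by exists y; rewrite // ltr0_norm.
Qed.

Lemma le_dist_right S (r : R) :
  (r%:E <= dist_right S) <-> (S : set R) `&` `]0%R, r[%classic = set0.
Proof.
split=> [rS|SE].
  apply/seteqP; split => // y [Sy] /=; rewrite in_itv/= => /andP[y0 yr].
  have : r%:E <= y%:E by apply: (le_trans rS); apply: ereal_inf_lbound; exists y.
  by rewrite lee_fin leNgt yr.
apply: le_ereal_inf_tmp => _ [y [Sy y0] <-]; rewrite lee_fin leNgt.
apply/negP => yr; have : (set0 : set R) y; last by [].
by rewrite -SE; split => //=; rewrite in_itv/= y0.
Qed.

Lemma measurable_ge d (T : measurableType d) (f : T -> \bar R) :
  (forall r : R, measurable [set t | r%:E <= f t]) -> measurable_fun setT f.
Proof.
move=> mf; apply: (measurability _ (ErealGenCInfty.measurableE R)) => _ [_ [r ->] <-].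
rewrite setTI (_ : _ @^-1` _ = [set t | r%:E <= f t])//.
by apply/seteqP; split => t /=; rewrite in_itv/= andbT.
Qed.

Lemma measurable_gap_left x : measurable_fun setT (gap_left x).
Proof.
apply: measurable_ge => r.
rewrite (_ : [set t | _] = [set S : config R | (S : set R) `&` `](- r)%R, x[%classic = set0]).
  exact: measurable_avoid.
by apply/seteqP; split => S /le_gap_left.
Qed.

Lemma measurable_dist_right : measurable_fun setT (@dist_right R).
Proof.
apply: measurable_ge => r.
rewrite (_ : [set t | _] = [set S : config R | (S : set R) `&` `]0%R, r[%classic = set0]).
  exact: measurable_avoid.
by apply/seteqP; split => S /le_dist_right.
Qed.

Lemma measurable_dist_left : measurable_fun setT (@dist_left R).
Proof.
rewrite (_ : @dist_left R = gap_left 0); first exact: measurable_gap_left.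
by apply/funext => S; exact: dist_leftE.
Qed.

Lemma measurable_blockage_dists : measurable_fun setT (@blockage_dists R).
Proof.
apply/measurable_fun_pairP; split => /=.
  by apply: (measurableT_comp measurable_dist_right); exact: measurable_snd.
by apply: (measurableT_comp measurable_dist_left); exact: measurable_snd.
Qed.

Lemma measurable_mem x : measurable [set S : config R | (S : set R) x].
Proof.
rewrite (_ : [set S | _] = ~` [set S : config R | (S : set R) `&` [set x] = set0]).
  by apply: measurableC; exact: measurable_avoid.
apply/seteqP; split => S /=.
  by move=> Sx SE; have : (set0 : set R) x by rewrite -SE.
move=> SE; apply: contrapT => Sx; apply: SE; apply/seteqP; split => // y [Sy yx].
by apply: Sx; rewrite -yx.
Qed.

Lemma measurable_mem1 p : measurable [set w : config R * config R | (w.1 : set R) p].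
Proof.
rewrite (_ : [set w | _] = [set S : config R | (S : set R) p] `*` setT).
  by apply: measurableX => //; exact: measurable_mem.
by apply/seteqP; split => w //= [].
Qed.

End nearest_points.

(** * Base stations and blockages under the Palm law at [x] *)

Section palm_law.
Local Open Scope ereal_scope.
Context (R : realType) (lambda mu x : R)
  (Q : probability (config R * config R)%type R).
Hypothesis hlambda : (0 < lambda)%R.
Hypothesis Qvacant : forall V J : set R, open V -> open J ->
  lebesgue_measure V < +oo -> lebesgue_measure J < +oo ->
  Q (vacant V J) = (\1_(~` V) x * vacant_prob lambda mu V J)%:E.

Lemma null_of_linear_bound (q : \bar R) (c r0 : R) : 0 <= q -> (0 < c)%R -> (0 < r0)%R ->
  (forall r : R, (0 < r)%R -> (r < r0)%R -> q <= (c * r)%:E) -> q = 0.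
Proof.
move=> q0 c0 r00 h; apply/eqP; rewrite eq_le q0 andbT; apply/lee_addgt0Pr => e e0.
(* The first term keeps [r] strictly below [r0], the second makes [c * r] at most [e]. *)
pose r := (Num.min (r0 / 2) (e / c))%R.
have rpos : (0 < r)%R by rewrite lt_min !divr_gt0.
have rr0 : (r < r0)%R by rewrite gt_min ltr_pdivrMr// ltr_pMr ?ltr1n.
apply: (le_trans (h r rpos rr0)); rewrite add0e lee_fin mulrC -ler_pdivlMr//.
by rewrite ge_min lexx orbT.
Qed.

(** As [x] is outside [V], the probability of a base station in [V] is 1 - exp(-lambda |V|), and
    exp(u) >= 1 + u. *)
Lemma hit_le V (b : R) : open V -> ~ V x -> lebesgue_measure V <= b%:E ->
  Q (~` vacant V set0) <= (lambda * b)%:E.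
Proof.
move=> oV xV Vb; have Voo : lebesgue_measure V < +oo by exact: le_lt_trans (ltry b).
have mV := open_measurable oV.
rewrite probability_setC; last by apply: measurable_vacant.
rewrite Qvacant//; last by rewrite measure0.
rewrite indicE mem_set// mul1r /vacant_prob measure0 mulr0 oppr0 expR0 mulr1.
rewrite -EFinB lee_fin.
have fb : (fine (lebesgue_measure V) <= b)%R.
  by rewrite -lee_fin fineK// ge0_fin_numE.
apply: (@le_trans _ _ (lambda * fine (lebesgue_measure V))%R); last by rewrite ler_pM2l.
by rewrite lerBlDr -lerBlDl expR_ge1Dx.
Qed.

Lemma measure_punctured (p r : R) : (0 < r)%R ->
  lebesgue_measure (`](p - r)%R, p[ `|` `]p, (p + r)%R[ : set R) <= (r + r)%:E.
Proof.
move=> r0.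
apply: (le_trans (measureU2 _ _ _)) => //.
have := lebesgue_measure_itv (`](p - r)%R, p[ : interval R) => /= ->.
have := lebesgue_measure_itv (`]p, (p + r)%R[ : interval R) => /= ->.
rewrite !lte_fin ltrBlDr ltrDl r0 -!EFinB -EFinD lee_fin.
lra.
Qed.

(* If [x] is not a point, then either a ball around [x] is empty, which has
   probability 0, or the punctured ball is not, which is unlikely when the ball
   is small. *)
Lemma palm_mem : Q [set w | (w.1 : set R) x] = 1.
Proof.
have mx := measurable_mem1 x.
suff : Q (~` [set w : config R * config R | (w.1 : set R) x]) = 0.
  move=> nx; rewrite -[X in Q X]setCK probability_setC ?nx ?sube0//.
  exact: measurableC.
apply: (@null_of_linear_bound _ (lambda * 2) 1) => // [|r r0 _].
  by rewrite mulr_gt0.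
pose B : set R := `](x - r)%R, (x + r)%R[%classic.
pose B' : set R := `](x - r)%R, x[ `|` `]x, (x + r)%R[.
have oB : open B by exact: itv_open.
have oB' : open B' by apply: openU; exact: itv_open.
have mB := open_measurable oB; have mB' := open_measurable oB'.
have vacantB : Q (vacant B set0) = 0.
  rewrite Qvacant// ?measure0//.
    rewrite indicE memNset ?mul0r// => h; apply: h; rewrite /B/= in_itv/=.
    lra.
  exact: itv_lty.
have xB' : ~ B' x by rewrite /B'/= !in_itv/= !ltxx andbF => -[].
have := hit_le oB' xB' (measure_punctured x r0).
rewrite -mulrA mulr_natl mulr2n => h; apply: le_trans h.
have sub : ~` [set w : config R * config R | (w.1 : set R) x] `<=`
    vacant B set0 `|` ~` vacant B' set0.
  move=> w /= wx; have [vB|vB] := pselect (vacant B set0 w); [by left|right => vB'].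
  apply: vB; case: vB' => h _; split; last by rewrite setI0.
  apply/seteqP; split => // y [wy]; rewrite /B/= in_itv/= => /andP[xy yx].
  have : ((w.1 : set R) `&` B') y; last by rewrite h.
  split => //; have [yltx|xlty|yE] := ltgtP y x.
  - by left; rewrite /= in_itv/= xy.
  - by right; rewrite /= in_itv/= xlty.
  - by exfalso; apply: wx; rewrite -yE.
have mv : measurable (vacant B set0) by exact: measurable_vacant.
have mv' : measurable (~` vacant B' set0) by apply: measurableC; exact: measurable_vacant.
apply: (@le_trans _ _ (Q (vacant B set0 `|` ~` vacant B' set0))).
  by apply: le_measure => //; apply: mem_set; [exact: measurableC|exact: measurableU].
have : Q (vacant B set0 `|` ~` vacant B' set0) <=
    Q (vacant B set0) + Q (~` vacant B' set0) by exact: measureU2.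
by rewrite vacantB add0e.
Qed.

(** A ball around [p] of radius [r < |x - p|] misses [x], so it contains a base station with
    probability at most [2 * lambda * r]. *)
Lemma palm_nomem p : p != x -> Q [set w | (w.1 : set R) p] = 0.
Proof.
move=> px.
have mp := measurable_mem1 p.
apply: (@null_of_linear_bound _ (lambda * 2) `|x - p|%R) => // [||r r0 rp].
- by rewrite mulr_gt0.
- by rewrite normr_gt0 subr_eq0 eq_sym.
pose B : set R := `](p - r)%R, (p + r)%R[%classic.
have oB : open B by exact: itv_open.
have xB : ~ B x.
  rewrite /B/= in_itv/= => h; have : (`|x - p| < r)%R; last by rewrite ltNge ltW.
  by rewrite ltr_norml; move: h; lra.
have muB : lebesgue_measure B <= (r + r)%:E.
  have := lebesgue_measure_itv (`](p - r)%R, (p + r)%R[ : interval R) => /= ->.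
  by case: ifP => _; rewrite -?EFinB lee_fin; lra.
have := hit_le oB xB muB; rewrite -mulrA mulr_natl mulr2n => h; apply: le_trans h.
apply: le_measure; [exact: mem_set| |].
  by apply: mem_set; apply: measurableC; apply: measurable_vacant => //; exact: open_measurable.
move=> w /= wp [h _]; have : ((w.1 : set R) `&` B) p; last by rewrite h.
by split => //; rewrite /B/= in_itv/=; lra.
Qed.

Let gap (w : config R * config R) : \bar R := gap_left x w.1.
Let qr (w : config R * config R) : \bar R := dist_right w.2.
Let ql (w : config R * config R) : \bar R := dist_left w.2.

(** Taking the measure of the interval instead of [x + m] also covers [x <= - m], where the interval
    is empty and the tail is 1. *)
Definition gap_tail (m : R) : R :=
  expR (- (lambda * fine (lebesgue_measure (`](- m)%R, x[%classic : set R)))).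

Let mgap : measurable_fun setT gap.
Proof. by apply: (measurableT_comp (measurable_gap_left x)); exact: measurable_fst. Qed.

Let mqr : measurable_fun setT qr.
Proof. by apply: (measurableT_comp (@measurable_dist_right R)); exact: measurable_snd. Qed.

Let mql : measurable_fun setT ql.
Proof. by apply: (measurableT_comp (@measurable_dist_left R)); exact: measurable_snd. Qed.

Lemma gap_tail_ge0 m : (0 <= gap_tail m)%R.
Proof. exact: expR_ge0. Qed.

(** The events are vacancies of the open sets [V], for base stations, and [J], for blockages. Since
    [x] is outside [V], [Qvacant] gives a product of one factor for each. *)
Lemma palm_gap_blockages (m r r' : R) :
  Q ([set w | m%:E <= gap w] `&` ([set w | r%:E <= qr w] `&` [set w | r'%:E <= ql w])) =
  (gap_tail m)%:E * Q ([set w | r%:E <= qr w] `&` [set w | r'%:E <= ql w]).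
Proof.
pose V : set R := `](- m)%R, x[%classic.
pose J : set R := `]0%R, r[ `|` `](- r')%R, 0%R[.
have oV : open V by exact: itv_open.
have oJ : open J by apply: openU; exact: itv_open.
have Voo : lebesgue_measure V < +oo by exact: itv_lty.
have Joo : lebesgue_measure J < +oo.
  apply: (@le_lt_trans _ _ (lebesgue_measure (`]0%R, r[%classic : set R) +
    lebesgue_measure (`](- r')%R, 0%R[%classic : set R))); first exact: measureU2.
  by rewrite lte_add_pinfty// itv_lty.
have xV : ~ V x by rewrite /V/= in_itv/= ltxx andbF.
have blockE : [set w | r%:E <= qr w] `&` [set w | r'%:E <= ql w] = vacant set0 J.
  apply/seteqP; split => w /=; rewrite /vacant/= setI0 /J setIUr.
    by move=> [/le_dist_right -> ]; rewrite /ql dist_leftE => /le_gap_left ->; rewrite setU0.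
  move=> [_]; rewrite setU_eq0 => -[h1 h2]; split.
    exact/le_dist_right.
  by rewrite /ql dist_leftE; exact/le_gap_left.
rewrite blockE.
have -> : [set w | m%:E <= gap w] `&` vacant set0 J = vacant V J.
  apply/seteqP; split => w /=; rewrite /vacant/=.
    by move=> [/le_gap_left ? [_ ?]].
  by move=> [? ?]; split; [exact/le_gap_left|rewrite setI0].
rewrite !Qvacant ?measure0//.
have ind1 (U : set R) : ~ U x -> \1_(~` U) x = 1%R :> R by move=> Ux; rewrite indicE mem_set.
rewrite !ind1 ?mul1r//.
by rewrite /vacant_prob measure0 mulr0 oppr0 expR0 mul1r EFinM.
Qed.

Let ErealGen_setI : setI_closed (@ErealGenCInfty.G R).
Proof.
move=> _ _ [a ->] [b ->]; exists (Num.max a b).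
apply/seteqP; split => y /=; rewrite !in_itv/= !andbT EFin_max ge_max.
  by move=> [-> ->].
by move=> /andP.
Qed.

Let rayE (f : config R * config R -> \bar R) (r : R) :
  f @^-1` `[r%:E, +oo[%classic = [set w | r%:E <= f w].
Proof. by apply/seteqP; split => w /=; rewrite in_itv/= andbT. Qed.

(** Setting a threshold to 0 removes the constraint, which yields the marginal identities from the
    joint one. *)
Let dists_ge0 : [set w | 0%:E <= qr w] = setT /\ [set w | 0%:E <= ql w] = setT.
Proof.
split; apply/seteqP; split => // w _ /=.
  by apply/le_dist_right; rewrite set_itvoo0 setI0.
by rewrite /ql dist_leftE; apply/le_gap_left; rewrite oppr0 set_itvoo0 setI0.
Qed.

Lemma palm_gap_tail (m : R) : Q [set w | m%:E <= gap w] = (gap_tail m)%:E.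
Proof.
have := palm_gap_blockages m 0 0; have [-> ->] := dists_ge0.
by rewrite !setIT probability_setT mule1.
Qed.

(** The product formula for rays is extended one variable at a time: to Borel sets for [qr], then
    for [ql], from rectangles to all measurable sets of pairs, and finally to Borel sets for
    [gap]. *)
Lemma palm_indep (A : set (\bar R)) (B : set (\bar R * \bar R)) :
  measurable A -> measurable B ->
  Q ((@blockage_dists R) @^-1` B `&` gap @^-1` A) =
  Q ((@blockage_dists R) @^-1` B) * Q (gap @^-1` A).
Proof.
have [qr0 ql0] := dists_ge0.
have mpre (f : config R * config R -> \bar R) C :
    measurable_fun setT f -> measurable C -> measurable (f @^-1` C).
  by move=> mf mC; rewrite -[_ @^-1` _]setTI; exact: mf.
have mray (f : config R * config R -> \bar R) (r : R) :
    measurable_fun setT f -> measurable [set w | r%:E <= f w].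
  by move=> mf; rewrite -rayE; apply: mpre => //; exact: emeasurable_itv.
have mER := ErealGenCInfty.measurableE R.
have step1 (m r' : R) B1 : measurable B1 ->
    Q (([set w | m%:E <= gap w] `&` [set w | r'%:E <= ql w]) `&` qr @^-1` B1) =
    (gap_tail m)%:E * Q ([set w | r'%:E <= ql w] `&` qr @^-1` B1).
  apply: (setI_preimage_generated mqr mER ErealGen_setI) => //.
  - by apply: measurableI; exact: mray.
  - exact: mray.
  - exact: gap_tail_ge0.
  - by have := palm_gap_blockages m 0 r'; rewrite qr0 !setTI.
  - by move=> _ [r ->]; rewrite rayE setIAC -setIA palm_gap_blockages setIC.
have step2 (m : R) B1 B2 : measurable B1 -> measurable B2 ->
    Q (([set w | m%:E <= gap w] `&` qr @^-1` B1) `&` ql @^-1` B2) =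
    (gap_tail m)%:E * Q (qr @^-1` B1 `&` ql @^-1` B2).
  move=> mB1; apply: (setI_preimage_generated mql mER ErealGen_setI) => //.
  - by apply: measurableI; [exact: mray|exact: mpre].
  - exact: mpre.
  - exact: gap_tail_ge0.
  - by have := step1 m 0%R _ mB1; rewrite ql0 setIT setTI.
  - by move=> _ [r ->]; rewrite rayE setIAC step1// setIC.
have step3 (m : R) C : measurable C ->
    Q ([set w | m%:E <= gap w] `&` (@blockage_dists R) @^-1` C) =
    (gap_tail m)%:E * Q (setT `&` (@blockage_dists R) @^-1` C).
  apply: (setI_preimage_generated (@measurable_blockage_dists R)
    (measurable_prod_measurableType _ _)) => //.
  - move=> _ _ [A1 mA1 [A2 mA2 <-]] [C1 mC1 [C2 mC2 <-]].
    exists (A1 `&` C1); first exact: measurableI.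
    by exists (A2 `&` C2); [exact: measurableI|rewrite setXI].
  - exact: mray.
  - exact: gap_tail_ge0.
  - have := step2 m setT setT measurableT measurableT.
    by rewrite !preimage_setT !setIT.
  - move=> _ [A1 mA1 [A2 mA2 <-]]; rewrite setTI.
    have -> : (@blockage_dists R) @^-1` (A1 `*` A2) = qr @^-1` A1 `&` ql @^-1` A2 by [].
    by rewrite setIA step2.
(* The roles are exchanged: the blockage event is now fixed with probability [c], and [step3]
   provides the rays for [gap]. *)
move=> mA mB; set c := Q (_ @^-1` B).
have mXB : measurable ((@blockage_dists R) @^-1` B).
  by rewrite -[_ @^-1` _]setTI; exact: measurable_blockage_dists.
have cE : c = (fine c)%:E by rewrite fineK// fin_num_measure.
rewrite cE -[gap @^-1` A in RHS]setTI.
move: A mA; apply: (setI_preimage_generated mgap mER ErealGen_setI) => //.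
- exact: fine_ge0 (measure_ge0 _ _).
- by rewrite -cE probability_setT mule1.
- move=> _ [m ->]; rewrite rayE setIC step3// -cE muleC /c.
  congr (_ * _); first by congr (Q _); exact: setTI.
  by rewrite -palm_gap_tail; congr (Q _); exact/esym/setTI.
Qed.

End palm_law.

(** * The service event *)

Section service_event.
Local Open Scope ereal_scope.
Context (R : realType).
Implicit Types (b : config R) (x y l : R) (ell : link -> R -> R).

Lemma link_type_pos b y : (0 < y)%R ->
  link_type b y = if y%:E < dist_right b then LoS else NLoS.
Proof.
move=> y0; rewrite /link_type; case: asboolP => [[[_ ->]|[]]//|h].
  by rewrite ltNge ltW.
by case: ifPn => // yb; exfalso; apply: h; left.
Qed.

Lemma link_type_neg b y : (y < 0)%R ->
  link_type b y = if (- y)%:E < dist_left b then LoS else NLoS.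
Proof.
move=> y0; rewrite /link_type ltr0_norm//; case: asboolP => [[[]|[_ ->]]//|h].
  by rewrite ltNge ltW.
by case: ifPn => // yb; exfalso; apply: h; right.
Qed.

Lemma link_type0 b : link_type b 0 = NLoS.
Proof. by rewrite /link_type asboolF// ltxx => -[[]|[]]. Qed.

Lemma gap_leftP x (S : config R) (m : \bar R) :
  m <= gap_left x S <-> forall y, (S : set R) y -> (y < x)%R -> m <= (- y)%R%:E.
Proof.
split=> [mS y Sy yx|h]; last first.
  by apply: le_ereal_inf_tmp => _ [y [Sy yx] <-]; exact: h.
by apply: (le_trans mS); apply: ereal_inf_lbound; exists y.
Qed.

(* With [l] and [hi] the exclusion radii of NLoS and LoS points and [t] the
   distance to the nearest blockage on the left, a point at distance [z] on the
   left does not interfere when [clip l hi t < z], and does when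
   [z < clip l hi t]. *)
Definition clip (l : R) (hi t : \bar R) : \bar R := maxe l%:E (mine t hi).

(** For [x > 0] the type at [x] depends on the right distance only; it is put as a set of pairs to
    be an event of the blockage distances. *)
Definition type_event x s : set (\bar R * \bar R) :=
  match s with
  | LoS => [set p | x%:E < p.1]
  | NLoS => [set p | p.1 <= x%:E]
  end.

Lemma link_type_event b x s : (0 < x)%R ->
  link_type b x = s <-> type_event x s (dist_right b, dist_left b).
Proof.
move=> x0; rewrite link_type_pos//; case: s => /=; case: ltP => //.
Qed.

(* An exact equality, tie cases included: the Palm measure says nothing about
   [served_by] until this set is known to be measurable. *)
Lemma served_byE ell s x l : (0 < x)%R -> (0 <= l)%R -> (l <= x)%R ->
  excl ell NLoS s x = l%:E -> x%:E <= excl ell LoS s x ->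
  served_by ell s x =
  [set w | (w.1 : set R) x] `&` (@blockage_dists R) @^-1` type_event x s `&`
  [set w | clip l (excl ell LoS s x) (dist_left w.2) <= gap_left x w.1] `&`
  ~` [set w | (w.1 : set R) 0%R] `&` ~` [set w | (w.1 : set R) (- l)%R] `&`
  ([set w | dist_left w.2 <= excl ell LoS s x] `|`
   ~` [set w | (w.1 : set R) (- fine (excl ell LoS s x))%R]).
Proof.
move=> x0 l0 lx lE; set hi := excl ell LoS s x => xhi.
have lhi : l%:E <= hi by apply: le_trans xhi; rewrite lee_fin.
apply/seteqP; split => [[S b]|[S b]]; rewrite /served_by/=.
- move=> [Sx bs served].
  have neg y : S y -> (y < 0)%R -> l%:E < (- y)%:E /\ (dist_left b <= (- y)%:E \/ hi < (- y)%:E).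
    move=> Sy y0; have yx : y <> x by move=> yx; move: y0; rewrite yx ltNge ltW.
    have := served y Sy yx; rewrite ltr0_norm// link_type_neg//.
    case: (ltP (- y)%:E (dist_left b)) => [_|by_]; rewrite ?lE => h; last by split => //; left.
    by split; [exact: (le_lt_trans lhi h)|right].
  (* The origin is of type NLoS by definition, and its distance 0 does not exceed [l]. *)
  have S0 : ~ S 0%R.
    move=> S0; have x0' : 0%R <> x by move=> e; move: x0; rewrite -e ltxx.
    by have := served _ S0 x0'; rewrite link_type0 normr0 lE lte_fin ltNge l0.
  split; first split; first split; first split; first split => //.
  + exact/(link_type_event _ _ x0).
  + apply/gap_leftP => y Sy yx.
    have [y0|y0|y0] := ltgtP y 0%R; last by move: Sy; rewrite y0.
      have [ly qy] := neg y Sy y0.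
      rewrite /clip ge_max ltW//= ge_min.
      by case: qy => [->//|/ltW ->]; rewrite orbT.
    have := served y Sy _; rewrite gtr0_norm// => h.
    have {h} : excl ell (link_type b y) s x < y%:E.
      by apply: h => yx'; move: yx; rewrite yx' ltxx.
    (* No base station lies between 0 and [x]: a LoS one would be within [hi >= x], and an NLoS one
       makes [x] NLoS too, with exclusion radius [x]. *)
    rewrite link_type_pos//; case: (ltP y%:E (dist_right b)) => [_|by_].
      by rewrite -/hi ltNge (le_trans _ xhi)// lee_fin ltW.
    move: bs; rewrite link_type_pos//; case: (ltP x%:E (dist_right b)) => [xb|_] sE.
      by move: (lt_le_trans xb by_); rewrite lte_fin ltNge ltW.
    by rewrite -sE/= lte_fin ltNge ltW.
  + exact: S0.
  + move=> Sl; have [l00|l0'] := eqVneq l 0%R; first by move: Sl; rewrite l00 oppr0.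
    have /neg : S (- l)%R by [].
    by rewrite oppr_lt0 lt_neqAle eq_sym l0' l0 opprK ltxx => /(_ isT)[].
  (* The tie at distance [hi]: if [hi < dist_left b], then [hi] is finite and a base station at
     [- hi] is LoS, hence interferes, while the weak bound on the gap allows it. *)
  + have [|hib] := leP (dist_left b) hi; [by left|right => /= Shi].
    have hif : hi \is a fin_num.
      rewrite fin_numE; apply/andP; split.
        by rewrite gt_eqF// (lt_le_trans _ xhi)// ltNyr.
      by rewrite lt_eqF// (lt_le_trans hib)// leey.
    have hi0 : (0 < fine hi)%R.
      by rewrite -lte_fin fineK// (lt_le_trans _ xhi).
    have /neg : S (- fine hi)%R by [].
    rewrite oppr_lt0 hi0 opprK fineK// ltxx => /(_ isT)[_ []//].
    by rewrite leNgt hib.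
- move=> [[[[[Sx bs] Sgap] S0] Sl] Shi]; split => //.
    exact/(link_type_event _ _ x0).
  move/gap_leftP : Sgap => Sgap y Sy yx.
  have [y0|y0|y0] := ltgtP y 0%R; last by move: Sy; rewrite y0.
    have := Sgap y Sy (lt_trans y0 x0); rewrite /clip ge_max => /andP[ly].
    rewrite ltr0_norm// link_type_neg// ge_min.
    case: (ltP (- y)%:E (dist_left b)) => [yb|_] /orP h.
      case: h => [//|hiy].
      rewrite -/hi lt_neqAle hiy andbT; apply/eqP => hiE.
      case: Shi; rewrite hiE/=; first by rewrite leNgt yb.
      by rewrite opprK.
    rewrite lE lt_neqAle ly andbT; apply/eqP => -[lE'].
    by apply: Sl; rewrite lE' opprK.
  have [yltx|xlty|yE] := ltgtP y x; last by [].
    have := Sgap y Sy yltx; rewrite /clip ge_max lee_fin => /andP[ly _].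
    by move: (le_trans l0 ly); rewrite oppr_ge0 leNgt y0.
  (* Beyond [x], a base station can be LoS only if [x] is LoS, and then the radius is [x]. *)
  rewrite gtr0_norm// link_type_pos//; case: (ltP y%:E (dist_right b)) => [yb|_]; last first.
    by rewrite lE lte_fin (le_lt_trans lx).
  move: bs; rewrite /hi; case: (s) => /= bs; first by rewrite lte_fin.
  by move: (lt_le_trans yb bs); rewrite lte_fin ltNge ltW.
Qed.

End service_event.

(** * Conditional probability of service given the blockage distances *)

Section conditional_probability.
Local Open Scope ereal_scope.
Context (R : realType) (lambda mu x : R)
  (Q : probability (config R * config R)%type R).
Hypothesis hlambda : (0 < lambda)%R.
Hypothesis Qvacant : forall V J : set R, open V -> open J ->
  lebesgue_measure V < +oo -> lebesgue_measure J < +oo ->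
  Q (vacant V J) = (\1_(~` V) x * vacant_prob lambda mu V J)%:E.
Hypothesis hx : (0 < x)%R.

Let W := (config R * config R)%type.

Let mgap : measurable_fun setT (fun w : W => gap_left x w.1).
Proof. by apply: (measurableT_comp (measurable_gap_left x)); exact: measurable_fst. Qed.

Let X : {mfun W >-> (\bar R * \bar R)%type} :=
  mfun_Sub (mem_set (@measurable_blockage_dists R)).
Let Z : {mfun W >-> \bar R} := mfun_Sub (mem_set mgap).

Lemma measurable_clip (l : R) (hi : \bar R) : measurable_fun setT (clip l hi).
Proof. by apply: measurable_maxe => //; apply: measurable_mine. Qed.

Lemma measurable_type_event s : measurable (type_event x s).
Proof.
case: s; rewrite /=.
- by rewrite -[X in measurable X]setTI; exact: emeasurable_fun_o_infty.
- by rewrite -[X in measurable X]setTI; exact: emeasurable_fun_infty_c.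
Qed.

Definition service_region s (l : R) (hi : \bar R) : set ((\bar R * \bar R) * \bar R) :=
  [set u | type_event x s u.1 /\ clip l hi u.1.2 <= u.2].

Lemma measurable_service_region s l hi : measurable (service_region s l hi).
Proof.
rewrite (_ : service_region s l hi = (type_event x s `*` setT) `&`
  [set u | clip l hi u.1.2 <= u.2]); last first.
  by apply/seteqP; split => u; rewrite /service_region/=; [case|case=> -[]].
apply: measurableI; first by apply: measurableX => //; exact: measurable_type_event.
rewrite -[X in measurable X]setTI; apply: emeasurable_fun_le => //.
  apply: (measurableT_comp (measurable_clip l hi)).
  by apply: (measurableT_comp measurable_snd); exact: measurable_fst.
Qed.

(** By [served_byE] the two events differ only when [x] carries no base station or when one sits at
    0, [- l] or [- hi]; each case is null under [Q]. *)
Lemma palm_served ell s l A : (0 <= l)%R -> (l <= x)%R ->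
  excl ell NLoS s x = l%:E -> x%:E <= excl ell LoS s x -> measurable A ->
  Q (served_by ell s x `&` (@blockage_dists R) @^-1` A) =
  Q [set w | (service_region s l (excl ell LoS s x) `&` A `*` setT) (X w, Z w)].
Proof.
move=> l0 lx lE xhi mA; rewrite (served_byE hx l0 lx lE xhi).
set hi := excl ell LoS s x in xhi *.
have mXA C : measurable C -> measurable (X @^-1` C) by move=> mC; exact: measurable_funPTI.
have mgapclip : measurable [set w : W | clip l hi (dist_left w.2) <= gap_left x w.1].
  rewrite -[X in measurable X]setTI; apply: emeasurable_fun_le => //.
  apply: (measurableT_comp (measurable_clip l hi)).
  by apply: (measurableT_comp (@measurable_dist_left R)); exact: measurable_snd.
have mhi : measurable [set w : W | dist_left w.2 <= hi].
  rewrite -[X in measurable X]setTI; apply: emeasurable_fun_infty_c => //.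
  by apply: (measurableT_comp (@measurable_dist_left R)); exact: measurable_snd.
have fhi : (0 <= fine hi)%R by rewrite fine_ge0// (le_trans _ xhi)// lee_fin ltW.
(* If [hi] is infinite, [fine hi] is 0, still a location different from [x]. *)
pose N : set W := ~` [set w | (w.1 : set R) x] `|` [set w | (w.1 : set R) 0%R]
  `|` [set w | (w.1 : set R) (- l)%R] `|` [set w | (w.1 : set R) (- fine hi)%R].
have mN : measurable N.
  do 3 (apply: measurableU; last exact: measurable_mem1).
  by apply: measurableC; exact: measurable_mem1.
apply: (@eq_probability_mod_null _ _ _ _ _ _ N) => //.
- apply: measurableI; last exact: mXA.
  apply: measurableI; last by apply: measurableU => //; apply: measurableC; exact: measurable_mem1.
  do 2 (apply: measurableI; last by apply: measurableC; exact: measurable_mem1).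
  apply: measurableI => //; apply: measurableI; first exact: measurable_mem1.
  by apply: mXA; exact: measurable_type_event.
- rewrite -[X in measurable X]setTI.
  have mXZ : measurable_fun setT (fun w => (X w, Z w)).
    by apply/measurable_fun_pairP; split; exact: measurable_funP.
  apply: mXZ => //; apply: measurableI; first exact: measurable_service_region.
  exact: measurableX.
- have nm p : p != x -> Q [set w | (w.1 : set R) p] = 0 by exact: (palm_nomem hlambda Qvacant).
  have U0 (A1 A2 : set W) : measurable A1 -> measurable A2 ->
      Q A1 = 0 -> Q A2 = 0 -> Q (A1 `|` A2) = 0.
    by move=> m1 m2 A10 A20; rewrite measureU0.
  have mm := @measurable_mem1 R.
  have mx : measurable (~` [set w : W | (w.1 : set R) x]) by exact: measurableC.
  have Nx : Q (~` [set w : W | (w.1 : set R) x]) = 0.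
    by rewrite probability_setC// (palm_mem hlambda Qvacant) subee.
  have xl : (- l)%R != x by rewrite lt_eqF// (le_lt_trans _ hx)// oppr_le0.
  have xfhi : (- fine hi)%R != x by rewrite lt_eqF// (le_lt_trans _ hx)// oppr_le0.
  have x0 : 0%R != x by rewrite lt_eqF.
  have m1 := measurableU _ _ mx (mm 0%R); have m2 := measurableU _ _ m1 (mm (- l)%R).
  apply: (U0 _ _ m2 (mm _) _ (nm _ xfhi)); apply: (U0 _ _ m1 (mm _) _ (nm _ xl)).
  exact: (U0 _ _ mx (mm _) Nx (nm _ x0)).
- move=> w [[[[[[wx K] C] _] _] _] wA]; left; do 2 split => //.
- move=> w [[K C] [wA _]].
  have [|nN] := pselect (N w); [by right|left].
  split => //; split; last by right => h; apply: nN; right.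
  split; last by move=> h; apply: nN; left; right.
  split; last by move=> h; apply: nN; do 2 left; right.
  by do 2 split => //; apply: contrapT => h; apply: nN; do 3 left.
Qed.

(** Only the gap is random here, the blockage distances being frozen at [p]. *)
Definition service_prob s (l : R) (hi : \bar R) (p : \bar R * \bar R) : R :=
  fine (distribution Q Z (xsection (service_region s l hi) p)).

(** By independence and Fubini, [g] and [service_prob] have equal integrals over all measurable sets
    of blockage distances. They agree almost everywhere for the law of these distances, and the
    exceptional set is pulled back to [Q]. *)
Lemma cond_prob_service ell s l g : (0 <= l)%R -> (l <= x)%R ->
  excl ell NLoS s x = l%:E -> x%:E <= excl ell LoS s x ->
  is_cond_prob Q (served_by ell s x) (@blockage_dists R) g ->
  \forall w \ae Q, g (blockage_dists w) =
    service_prob s l (excl ell LoS s x) (blockage_dists w).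
Proof.
move=> l0 lx lE xhi [mg ig gE]; set hi := excl ell LoS s x.
have mD := measurable_service_region s l hi.
have mD0 := measurable_fun_xsection (distribution Q Z) mD.
have fin_prob p : distribution Q Z (xsection (service_region s l hi) p) \is a fin_num.
  by apply: fin_num_measure; exact: measurable_xsection.
have mgE : measurable_fun setT (EFin \o g) by exact/measurable_EFinP.
have ae_law : ae_eq (distribution Q X) setT (EFin \o g) (EFin \o service_prob s l hi).
  apply: integral_ae_eq => //.
  - exact: integrable_pushforward.
  - by apply/measurable_EFinP; apply: measurableT_comp.
  - move=> E _ mE; rewrite integral_pushforward//; last first.
      by apply: integrableS ig => //; exact: measurable_funPTI.
    transitivity (Q (served_by ell s x `&` (@blockage_dists R) @^-1` E)).
      exact/esym/gE.
    rewrite (palm_served l0 lx lE xhi mE) joint_probabilityE; first last.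
    + by apply: measurableI => //; exact: measurableX.
    + by move=> B A mB mA; exact: (palm_indep Qvacant).
    rewrite [RHS]integral_mkcond; apply: eq_integral => p _.
    rewrite patchE; case: ifPn => pE.
      rewrite /service_prob/= fineK//; congr (distribution Q Z _).
      apply/seteqP; split => z; rewrite /xsection/= !inE; first by case.
      by move=> ?; split=> //; split => //; exact: set_mem.
    rewrite (_ : xsection _ _ = set0) ?measure0//.
    apply/seteqP; split => // z; rewrite /xsection/= inE => -[_ [/= /mem_set]].
    by rewrite (negbTE pE).
case: ae_law => N [mN N0 subN]; exists (X @^-1` N); split => //.
  exact: measurable_funPTI.
move=> w /= gw; apply: subN => /= /(_ I) h; apply: gw.
by case: h.
Qed.

(** At fixed distances the section is empty or the ray from [m]; as [- m <= 0 < x], the interval to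
    be vacant has length [x + m]. *)
Lemma service_probE s (l m : R) (hi : \bar R) (p : \bar R * \bar R) :
  (0 <= m)%R -> clip l hi p.2 = m%:E ->
  service_prob s l hi p =
  ((if `[< type_event x s p >] then 1 else 0) * expR (- (lambda * (x + m))))%R.
Proof.
move=> m0 pm; rewrite /service_prob.
have [Kp|Kp] := asboolP (type_event x s p); last first.
  rewrite (_ : xsection _ _ = set0) ?measure0 ?mul0r//.
  by apply/seteqP; split => // z; rewrite /xsection/= inE => -[].
rewrite (_ : xsection _ _ = [set z | m%:E <= z]); last first.
  by apply/seteqP; split => z; rewrite /xsection/= inE /service_region/= pm //; case.
rewrite mul1r -[distribution _ _ _]/(Q [set w | m%:E <= gap_left x w.1]).
rewrite (palm_gap_tail Qvacant) /= /gap_tail lebesgue_measure_itv/= lte_fin.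
by rewrite (le_lt_trans _ hx) ?oppr_le0//= opprK.
Qed.

End conditional_probability.

(* In each branch below the quantity under [fine] is finite. *)
Theorem lemma1 (R : realType) (d : measure_display) (Omega : measurableType d)
    (P : probability Omega R) (lambda mu : R)
    (Phi Psi : {RV P >-> config R})
    (Palm : R.-pker R ~> (config R * config R)%type)
    (ell : link -> R -> R)
    (hlambda : 0 < lambda) (hmu : 0 < mu)
    (hPhi : is_PPP lambda Phi) (hPsi : is_PPP mu Psi)
    (hindep : independent_RV Phi Psi)
    (hPalm : is_Palm lambda Phi Psi Palm)
    (ell_ge0 : forall s (y : R), 0 <= y -> 0 <= ell s y)
    (ell_bounded : forall s, exists M : R, forall y : R, 0 <= y -> ell s y <= M)
    (ell_noninc : forall s (y z : R), 0 <= y -> y <= z -> ell s z <= ell s y)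
    (ell_LN : forall y : R, 0 <= y -> ell NLoS y <= ell LoS y)
    (hexcl : forall y : R, 0 < y ->
       (excl ell NLoS LoS y < y%:E)%E /\ (y%:E < excl ell LoS NLoS y)%E)
    (x : R) (hx : 0 < x)
    (gL gN : \bar R * \bar R -> R)
    (hgL : is_cond_prob (Palm x) (served_by ell LoS x) (@blockage_dists R) gL)
    (hgN : is_cond_prob (Palm x) (served_by ell NLoS x) (@blockage_dists R) gN) :
  {ae Palm x, forall w : config R * config R,
    let q := dist_right w.2 in
    let q' := dist_left w.2 in
    let eNL := excl ell NLoS LoS x in
    let eLN := excl ell LoS NLoS x in
    let ind_lt : R := if (x%:E < q)%E then 1 else 0 in
    let ind_ge : R := if (q <= x%:E)%E then 1 else 0 in
    [/\ (q' <= eNL)%E ->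
          gL (q, q') = ind_lt * expR (- (lambda * x)) * expR (- (lambda * fine eNL)),
        (eNL <= q')%E -> (q' < x%:E)%E ->
          gL (q, q') = ind_lt * expR (- (lambda * x)) * expR (- (lambda * fine q')) &
        (x%:E <= q')%E ->
          gL (q, q') = ind_lt * expR (- (2 * lambda * x))] /\
    [/\ (q' < x%:E)%E ->
          gN (q, q') = ind_ge * expR (- (2 * lambda * x)),
        (x%:E < q')%E -> (q' < eLN)%E ->
          gN (q, q') = ind_ge * expR (- (lambda * x)) * expR (- (lambda * fine q')) &
        (eLN < q')%E ->
          gN (q, q') = ind_ge * expR (- (lambda * x)) * expR (- (lambda * fine eLN))]}.
Proof.
have [eNLx xeLN] := hexcl x hx.
have eNL0 : (0 <= excl ell NLoS LoS x)%E.
  by apply: le_ereal_inf_tmp => _ [y [y0 _] <-]; rewrite lee_fin.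
have eNLE : excl ell NLoS LoS x = (fine (excl ell NLoS LoS x))%:E.
  by rewrite fineK// ge0_fin_numE// (lt_trans eNLx)// ltry.
set l := fine (excl ell NLoS LoS x) in eNLE.
have l0 : 0 <= l by exact: fine_ge0.
have lx : l < x by rewrite -lte_fin -eNLE.
have Qvacant V J := @Palm_vacant R d Omega P lambda mu Phi Psi Palm
  hlambda hmu hPhi hPsi hindep hPalm x V J.
(* The NLoS and LoS exclusion radii are [l] and [x] for LoS service, and [x] and
   [excl ell LoS NLoS x] for NLoS service. *)
have aeL := @cond_prob_service R lambda mu x (kernel_at Palm x) hlambda Qvacant hx
  ell LoS l gL l0 (ltW lx) eNLE (lexx _) hgL.
have aeN := @cond_prob_service R lambda mu x (kernel_at Palm x) hlambda Qvacant hx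
  ell NLoS x gN (ltW hx) (lexx x) erefl (ltW xeLN) hgN.
have indL q q' : (if `[< type_event x LoS (q, q') >] then 1 else 0 : R) =
    if (x%:E < q)%E then 1 else 0 by rewrite asboolb.
have indN q q' : (if `[< type_event x NLoS (q, q') >] then 1 else 0 : R) =
    if (q <= x%:E)%E then 1 else 0 by rewrite asboolb.
have service := @service_probE R lambda mu x (kernel_at Palm x) Qvacant hx.
apply: filterS2 aeL aeN => w; rewrite /blockage_dists.
set q := dist_right w.2; set q' := dist_left w.2 => -> -> /=.
have expE m : expR (- (lambda * (x + m))) = expR (- (lambda * x)) * expR (- (lambda * m)).
  by rewrite -expRD mulrDr opprD.
have xx2 : expR (- (lambda * (x + x))) = expR (- (2 * lambda * x)).
  by congr expR; ring.
have evalL m : 0 <= m -> clip l x%:E q' = m%:E ->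
    service_prob x (kernel_at Palm x) LoS l x%:E (q, q') =
    (if (x%:E < q)%E then 1 else 0) * expR (- (lambda * x)) * expR (- (lambda * m)).
  by move=> m0 h; rewrite (service LoS l m)// indL expE mulrA.
have evalN m : 0 <= m -> clip x (excl ell LoS NLoS x) q' = m%:E ->
    service_prob x (kernel_at Palm x) NLoS x (excl ell LoS NLoS x) (q, q') =
    (if (q <= x%:E)%E then 1 else 0) * expR (- (lambda * x)) * expR (- (lambda * m)).
  by move=> m0 h; rewrite (service NLoS x m)// indN expE mulrA.
(* The branches evaluate [clip]: to [l], [q'], [x] for LoS service, and to [x], [q'],
   [excl ell LoS NLoS x] for NLoS service. *)
split; split.
- move=> q'e; have q'l : (q' <= l%:E)%E by rewrite -eNLE.
  apply: evalL => //; by rewrite /clip min_l ?max_l// (le_trans q'l)// lee_fin ltW.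
- move=> eq' q'x; have lq' : (l%:E <= q')%E by rewrite -eNLE.
  have q'E : q' = (fine q')%:E.
    by rewrite fineK// fin_numE gt_eqF ?lt_eqF ?(lt_trans q'x) ?ltry// (lt_le_trans _ lq') ?ltNyr.
  apply: evalL; first by rewrite -lee_fin -q'E (le_trans _ lq').
  by rewrite /clip min_l ?max_r -?q'E// ltW.
- move=> xq'; rewrite -xx2 expE mulrA; apply: evalL; first exact: ltW.
  by rewrite /clip min_r// max_r// lee_fin ltW.
- move=> q'x; rewrite -xx2 expE mulrA; apply: evalN; first exact: ltW.
  by rewrite /clip min_l ?max_l ?(ltW q'x)// ltW// (lt_trans q'x).
- move=> xq' q'e.
  have q'E : q' = (fine q')%:E.
    by rewrite fineK// fin_numE gt_eqF ?lt_eqF ?(lt_le_trans q'e) ?leey// (lt_trans _ xq') ?ltNyr.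
  apply: evalN; first by rewrite -lee_fin -q'E ltW// (lt_trans _ xq').
  by rewrite /clip min_l ?max_r -?q'E// ltW.
- move=> eq'; have eE : excl ell LoS NLoS x = (fine (excl ell LoS NLoS x))%:E.
    by rewrite fineK// fin_numE gt_eqF ?lt_eqF ?(lt_le_trans eq') ?leey// (lt_trans _ xeLN) ?ltNyr.
  apply: evalN; first by rewrite -lee_fin -eE ltW// (lt_trans _ xeLN).
  by rewrite /clip min_r ?max_r -?eE// ltW.
Qed.
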